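(* Let $D$ be a Prüfer domain and let $X\subseteq\mathrm{Max}(D)$ be a splitting set of $D$. Then $\mathrm{Div}_X(D)$ is a convex subgroup of $\mathrm{Div}(D)$; moreover, $\mathrm{Div}_X(D)$ is a complete $\ell$-group and is the completion of $\mathrm{Inv}_X(D)$.
   Context: $K$ is the quotient field of $D$. A fractional ideal of $D$ is a (nonzero) $D$-submodule $I\subseteq K$ with $dI\subseteq D$ for some nonzero $d\in D$. $\mathrm{Inv}(D)$ is the group of invertible fractional ideals under multiplication. For a fractional ideal $I$, $(D:I):=\{x\in K\mid xI\subseteq D\}$ and $I^v:=(D:(D:I))$; $I$ is divisorial if $I=I^v$ and $v$-invertible if $(IJ)^v=D$ for some fractional ideal $J$. $\mathrm{Div}(D)$ is the group of $v$-invertible divisorial fractional ideals under the $v$-product $I\times_vJ:=(IJ)^v$. Both $\mathrm{Inv}(D)$ and $\mathrm{Div}(D)$ are ordered by reverse containment. For $X\subseteq\mathrm{Spec}(D)$, $X^\uparrow:=\{P\in\mathrm{Spec}(D)\mid Q\subseteq P\text{ for some }Q\in X\}$. The inverse topology on $\mathrm{Spec}(D)$ is the topology having as a subbasis of open sets the sets $\mathcal V(I)=\{P\in\mathrm{Spec}(D)\mid I\subseteq P\}$, for $I$ a finitely generated ideal. $X$ is a splitting set if $X=X^\uparrow$ and $X$ is open in the inverse topology (equivalently, $X=X^\uparrow$ and $\mathrm{Spec}(D)\setminus X$ is quasi-compact in the Zariski topology). The support of a fractional ideal $I$ is $\mathrm{supp}(I):=\{P\in\mathrm{Spec}(D)\mid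 ID_P\neq D_P\}$. $\mathrm{Inv}_X(D):=\{I\in\mathrm{Inv}(D)\mid\mathrm{supp}(I)\subseteq X\}$ and $\mathrm{Div}_X(D):=\{I\in\mathrm{Div}(D)\mid\mathrm{supp}(I)\subseteq X\text{ and }\mathrm{supp}((D:I))\subseteq X\}$. A subgroup $H$ of an ordered group is convex if $a<b<c$ with $a,c\in H$ implies $b\in H$. An $\ell$-group is an ordered group whose order is a lattice; it is complete if every nonempty subset that is bounded above has a supremum (equivalently, every nonempty subset bounded below has an infimum). The completion of an (archimedean) $\ell$-group $G$ is its usual (Dedekind) completion: the minimal complete $\ell$-group containing $G$ as a dense $\ell$-subgroup, i.e. a complete $\ell$-group $\widehat G\supseteq G$ in which every element is the supremum of the elements of $G$ below it and the infimum of the elements of $G$ above it. *)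

(* Defs.v *)
From HB Require Import structures.
From mathcomp Require Import all_boot all_order all_algebra.
From mathcomp Require Import ring_quotient.
From mathcomp Require Import boolp classical_sets topology.
Set Implicit Arguments.
Unset Strict Implicit.
Unset Printing Implicit Defensive.
Import GRing.Theory.
Local Open Scope classical_set_scope.
Local Open Scope ring_scope.

Record pogroup_data (T : Type) := POGroupData {
  pog_car : set T;
  pog_mul : T -> T -> T;
  pog_one : T;
  pog_le : T -> T -> Prop }.

Record ordered_group (T : Type) (G : pogroup_data T) : Prop := OrderedGroup {
  og_mul_closed : forall a b,
    pog_car G a -> pog_car G b -> pog_car G (pog_mul G a b);
  og_one : pog_car G (pog_one G);
  og_mulA : forall a b c, pog_car G a -> pog_car G b -> pog_car G c ->
    pog_mul G a (pog_mul G b c) = pog_mul G (pog_mul G a b) c;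
  og_1mul : forall a, pog_car G a -> pog_mul G (pog_one G) a = a;
  og_mul1 : forall a, pog_car G a -> pog_mul G a (pog_one G) = a;
  og_inv : forall a, pog_car G a -> exists b, [/\ pog_car G b,
    pog_mul G a b = pog_one G & pog_mul G b a = pog_one G];
  og_le_refl : forall a, pog_car G a -> pog_le G a a;
  og_le_anti : forall a b, pog_car G a -> pog_car G b ->
    pog_le G a b -> pog_le G b a -> a = b;
  og_le_trans : forall a b c, pog_car G a -> pog_car G b -> pog_car G c ->
    pog_le G a b -> pog_le G b c -> pog_le G a c;
  og_le_mul : forall a b c, pog_car G a -> pog_car G b -> pog_car G c ->
    pog_le G a b ->
    pog_le G (pog_mul G c a) (pog_mul G c b) /\
    pog_le G (pog_mul G a c) (pog_mul G b c) }.

Definition pog_lt (T : Type) (G : pogroup_data T) (a b : T) : Prop :=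
  pog_le G a b /\ a <> b.

Definition pog_restrict (T : Type) (G : pogroup_data T) (H : set T) :
    pogroup_data T :=
  POGroupData H (@pog_mul T G) (pog_one G) (@pog_le T G).

Definition subgroup (T : Type) (G : pogroup_data T) (H : set T) : Prop :=
  [/\ H `<=` pog_car G,
      H (pog_one G),
      (forall a b, H a -> H b -> H (pog_mul G a b)) &
      (forall a, H a -> exists2 b, H b & pog_mul G a b = pog_one G)].

Definition convex_subgroup (T : Type) (G : pogroup_data T) (H : set T) : Prop :=
  [/\ ordered_group G,
      subgroup G H &
      forall a b c, H a -> pog_car G b -> H c ->
        pog_lt G a b -> pog_lt G b c -> H b].

(* Bounds, suprema and infima are all taken inside the carrier. *)
Definition pog_ub (T : Type) (G : pogroup_data T) (S : set T) : set T :=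
  [set m | pog_car G m /\ forall s, S s -> pog_le G s m].

Definition pog_lb (T : Type) (G : pogroup_data T) (S : set T) : set T :=
  [set m | pog_car G m /\ forall s, S s -> pog_le G m s].

Definition pog_is_sup (T : Type) (G : pogroup_data T) (S : set T) (m : T) :=
  pog_ub G S m /\ forall u, pog_ub G S u -> pog_le G m u.

Definition pog_is_inf (T : Type) (G : pogroup_data T) (S : set T) (m : T) :=
  pog_lb G S m /\ forall l, pog_lb G S l -> pog_le G l m.

Definition lgroup (T : Type) (G : pogroup_data T) : Prop :=
  ordered_group G /\
  forall a b, pog_car G a -> pog_car G b ->
    (exists m, pog_is_sup G [set a; b] m) /\
    (exists m, pog_is_inf G [set a; b] m).

Definition complete_lgroup (T : Type) (G : pogroup_data T) : Prop :=
  lgroup G /\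
  forall S : set T, S `<=` pog_car G -> S !=set0 -> pog_ub G S !=set0 ->
    exists m, pog_is_sup G S m.

(* The two structures may come with different operations and orders (e.g. the
   product and the v-product of ideals), which must agree on [G]. *)
Record lsubgroup (T : Type) (G H : pogroup_data T) : Prop := LSubgroup {
  lsub_lgroupl : lgroup G;
  lsub_lgroupr : lgroup H;
  lsub_car : pog_car G `<=` pog_car H;
  lsub_mul : forall a b, pog_car G a -> pog_car G b ->
    pog_mul G a b = pog_mul H a b;
  lsub_le : forall a b, pog_car G a -> pog_car G b ->
    (pog_le G a b <-> pog_le H a b);
  lsub_sup : forall a b m, pog_car G a -> pog_car G b ->
    pog_is_sup G [set a; b] m -> pog_is_sup H [set a; b] m;
  lsub_inf : forall a b m, pog_car G a -> pog_car G b ->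
    pog_is_inf G [set a; b] m -> pog_is_inf H [set a; b] m }.

Definition is_completion (T : Type) (G H : pogroup_data T) : Prop :=
  [/\ complete_lgroup H,
      lsubgroup G H &
      forall h, pog_car H h ->
        pog_is_sup H [set g | pog_car G g /\ pog_le H g h] h /\
        pog_is_inf H [set g | pog_car G g /\ pog_le H h g] h].

(* [idealr_closed] only holds of proper ideals. *)
Record Spec (D : idomainType) := MkSpec {
  spec_ideal :> set D;
  spec_idealP : idealr_closed [in spec_ideal];
  spec_primeP : prime_idealr_closed [in spec_ideal] }.

HB.instance Definition _ (D : idomainType) := gen_eqMixin (Spec D).
HB.instance Definition _ (D : idomainType) := gen_choiceMixin (Spec D).

Definition Max (D : idomainType) : set (Spec D) :=
  [set P | forall J : set D, idealr_closed [in J] -> P `<=` J -> J = P].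

Definition fg_ideal (D : idomainType) : set (set D) :=
  [set I | exists s : seq D, I =
     [set x | exists c : 'I_(size s) -> D, x = \sum_(i < size s) c i * s`_i]].

Definition Vset (D : idomainType) (I : set D) : set (Spec D) :=
  [set P : Spec D | I `<=` P].

(* An alias of [Spec D] carrying the inverse topology, so that [Spec D] itself
   gets no canonical topology. *)
Definition inverse_spectrum (D : idomainType) : Type := Spec D.

HB.instance Definition _ (D : idomainType) := Choice.on (inverse_spectrum D).
HB.instance Definition _ (D : idomainType) :=
  isSubBaseTopological.Build (inverse_spectrum D) (@fg_ideal D) (@Vset D).

Definition upclosure (D : idomainType) (X : set (Spec D)) : set (Spec D) :=
  [set P : Spec D | exists2 Q : Spec D, X Q & Q `<=` P].

Definition splitting_set (D : idomainType) (X : set (Spec D)) : Prop :=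
  X = upclosure X /\ @open (inverse_spectrum D) X.

Definition ring_in_frac (D : idomainType) : set {fraction D} :=
  range (@tofrac D).
Arguments ring_in_frac : clear implicits.

Definition fractional_ideal (D : idomainType) (I : set {fraction D}) : Prop :=
  [/\ I 0,
      (forall x y, I x -> I y -> I (x + y)),
      (forall (a : D) x, I x -> I (tofrac a * x)),
      (exists2 x, I x & x != 0) &
      (exists2 d : D, d != 0 &
         forall x, I x -> ring_in_frac D (tofrac d * x))].

(* The product of submodules: finite sums of products. *)
Definition fmul (D : idomainType) (I J : set {fraction D}) :
    set {fraction D} :=
  [set x | exists2 s : seq ({fraction D} * {fraction D}),
     (forall p, p \in s -> I p.1 /\ J p.2) &
     x = \sum_(p <- s) p.1 * p.2].

Definition fcolon (D : idomainType) (I : set {fraction D}) :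
    set {fraction D} :=
  [set x | forall y, I y -> ring_in_frac D (x * y)].

Definition vclosure (D : idomainType) (I : set {fraction D}) :
    set {fraction D} := fcolon (fcolon I).

Definition vmul (D : idomainType) (I J : set {fraction D}) :
    set {fraction D} := vclosure (fmul I J).

Definition divisorial (D : idomainType) (I : set {fraction D}) : Prop :=
  I = vclosure I.

Definition invertible (D : idomainType) (I : set {fraction D}) : Prop :=
  exists2 J, fractional_ideal J & fmul I J = ring_in_frac D.

Definition v_invertible (D : idomainType) (I : set {fraction D}) : Prop :=
  exists2 J, fractional_ideal J & vmul I J = ring_in_frac D.

Definition prufer (D : idomainType) : Prop :=
  forall I : set D, fg_ideal I -> I <> [set 0] -> invertible (@tofrac D @` I).

Definition localization (D : idomainType) (P : Spec D) : set {fraction D} :=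
  [set x | exists a s : D, ~ (P : set D) s /\ x = tofrac a / tofrac s].

Definition supp (D : idomainType) (I : set {fraction D}) : set (Spec D) :=
  [set P : Spec D | fmul I (localization P) <> localization P].

Definition rev_incl (D : idomainType) (I J : set {fraction D}) : Prop :=
  J `<=` I.

Definition Inv (D : idomainType) : set (set {fraction D}) :=
  [set I | fractional_ideal I /\ invertible I].

Definition Div (D : idomainType) : set (set {fraction D}) :=
  [set I | [/\ fractional_ideal I, divisorial I & v_invertible I]].

Definition Inv_on (D : idomainType) (X : set (Spec D)) :
    set (set {fraction D}) :=
  [set I | Inv I /\ supp I `<=` X].

Definition Div_on (D : idomainType) (X : set (Spec D)) :
    set (set {fraction D}) :=
  [set I | [/\ Div I, supp I `<=` X & supp (fcolon I) `<=` X]].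

Definition Inv_group (D : idomainType) : pogroup_data (set {fraction D}) :=
  POGroupData (@Inv D) (@fmul D) (ring_in_frac D) (@rev_incl D).

Definition Div_group (D : idomainType) : pogroup_data (set {fraction D}) :=
  POGroupData (@Div D) (@vmul D) (ring_in_frac D) (@rev_incl D).

(* Main.v *)
Require Import Defs.
From mathcomp Require Import all_boot all_order all_algebra.
From mathcomp Require Import ring_quotient generic_quotient finmap ring.
From mathcomp Require Import boolp classical_sets topology.
(**
The group Div_X(D) is controlled from inside by Inv_X(D): a divisorial
fractional ideal J lies in Div_X(D) if and only if A <= J <= B for some A and B
in Inv_X(D), where <= is inclusion, the reverse of the order of the groups.
Convexity, completeness and density are then read off from this sandwich.

- Lower bounds ([Inv_on_below]).  If supp(J) is contained in X, every prime
  containing the integral part of J is in X.  As X is open in the inverse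
  topology, each P in X contains a finite list s such that all primes containing
  s are in X.  The family of lists with this property is closed under
  products, so an ideal containing none of them would be contained in a prime
  containing none of them ([prime_containing_no_list]), which contradicts
  openness.  Hence J contains such a list, which spans an invertible ideal
  because D is Prufer.  Upper bounds follow by applying this to (D : J)
  ([Div_on_bounds]).

- Conversely ([Div_on_sandwich]), the point is that a sandwiched divisorial J is
  v-invertible.  An element z with z J (D : J) contained in D multiplies
  J = (D : (D : J)) into itself, so one needs that every multiplier x of J is in
  D ([multiplier_sandwich]).  From x^n A <= x^n J <= B, the element x is almost
  integral: the ideal C of all c in D with x^n c in D for every n is such that
  the primes containing it are all in X, hence maximal.  This is where the
  inclusion of X in Max(D) enters.

- An almost integral x with such a C is in D ([almost_integral]).  Invertibility
  of (1, x) gives 1 = u + x v with u, v, u x, v x in D.  As D/C has dimension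
  zero, v^n (1 - r v) is in C for some n and r ([zero_dim_power]), so
  (x v)^n (1 - r v) x = (1 - u)^n (1 - r v) x is in D.  Since u x and v x are in
  D, this element is congruent to x modulo D.

With the sandwich at hand, suprema in Div_X(D) are intersections and infima are
obtained from suprema through J |-> (D : J).  For J in Div_X(D), every x in J is
in some A of Inv_X(D) contained in J, namely the span of x and a lower bound of J
([Inv_on_cover]).  So, in the order of the groups, J is the infimum of the
elements of Inv_X(D) above it and, by the same applied to (D : J), the supremum
of those below it.
*)

Set Implicit Arguments.
Unset Strict Implicit.
Unset Printing Implicit Defensive.
Import GRing.Theory FracField.
Local Open Scope ring_scope.
Local Open Scope classical_set_scope.

(** * Prime ideals containing a given ideal *)

Section Primes.
Variable D : idomainType.

Definition ideal_or_unit (J : set D) : Prop :=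
  [/\ J 0, (forall x y, J x -> J y -> J (x + y)) &
      (forall a x, J x -> J (a * x))].

Lemma Spec_ideal_or_unit (P : Spec D) : ideal_or_unit P.
Proof.
have [P0 _ PD] := spec_idealP P.
have P0' : (P : set D) 0 by rewrite inE in P0.
split=> // [x y Px Py|a x Px].
  by have := PD 1 x y; rewrite !inE mul1r; apply.
by have := PD a x 0; rewrite !inE addr0; apply.
Qed.

Lemma Spec_proper (P : Spec D) : ~ (P : set D) 1.
Proof.
by have [_ /negP P1 _] := spec_idealP P => P1'; apply: P1; rewrite inE.
Qed.

Lemma Spec_mul (P : Spec D) x y :
  (P : set D) (x * y) -> (P : set D) x \/ (P : set D) y.
Proof.
by move=> Pxy; have /orP := @spec_primeP D P x y (mem_set Pxy); rewrite !inE.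
Qed.

Lemma Spec_mul_notin (P : Spec D) x y :
  ~ (P : set D) x -> ~ (P : set D) y -> ~ (P : set D) (x * y).
Proof. by move=> Px Py /Spec_mul[]. Qed.

Definition in_all (s : seq D) (J : set D) := forall x, x \in s -> J x.

Definition seq_mul (s t : seq D) := [seq x * y | x <- s, y <- t].

(** Since the lists of [G] are finite, Zorn's lemma yields an ideal [M] over [J]
    that is maximal among those containing no list of [G].  If [x] and [y] are
    outside [M], the ideals [M + (x)] and [M + (y)] contain lists [s] and [t] of
    [G]; if [x y] were in [M], then [M] would contain the product of [s] and
    [t].  Taking one-element lists gives the usual avoidance of a
    multiplicative set. *)
Lemma prime_containing_no_list (G : set (seq D)) (J : set D) :
  G !=set0 -> (forall s t, G s -> G t -> G (seq_mul s t)) ->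
  ideal_or_unit J -> (forall s, G s -> ~ in_all s J) ->
  exists2 P : Spec D, J `<=` P & forall s, G s -> ~ in_all s P.
Proof.
move=> [s0 Gs0] Gmul [J0 JD JM] GJ.
(* Zorn's lemma for unions also considers the empty chain, whose union is the
   empty set; hence the candidates are the sets that become ideals once [J] is
   added to them. *)
pose Q (A : set D) :=
  ideal_or_unit (A `|` J) /\ (forall s, G s -> ~ in_all s (A `|` J)).
have [|A [[[M0 MD MM] GM] Amax]] := @Zorn_bigcup _ Q.
  move=> F FQ Ftot.
  have common A B : F A -> F B -> exists C, [/\ F C, A `<=` C & B `<=` C].
    by move=> FA FB; have [AB|BA] := Ftot _ _ FA FB; [exists B|exists A]; split.
  have pairP x y :
      (\bigcup_(B in F) B `|` J) x -> (\bigcup_(B in F) B `|` J) y ->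
      (J x /\ J y) \/ exists C, [/\ F C, (C `|` J) x & (C `|` J) y].
    move=> [[B FB Bx]|Jx] [[C FC Cy]|Jy].
    - have [E [FE BE CE]] := common _ _ FB FC.
      by right; exists E; split=> //; left; [apply: BE|apply: CE].
    - by right; exists B; split=> //; [left|right].
    - by right; exists C; split=> //; [right|left].
    - by left.
  split.
    split; first by right.
      move=> x y Ux Uy; have [[Jx Jy]|[C [FC Cx Cy]]] := pairP _ _ Ux Uy.
        by right; apply: JD.
      have [[_ CD _] _] := FQ _ FC.
      by have [Cxy|Jxy] := CD _ _ Cx Cy; [left; exists C|right].
    move=> a x [[C FC Cx]|Jx]; last by right; apply: JM.
    have [[_ _ CM] _] := FQ _ FC.
    by have [] := CM a x (or_introl Cx); [left; exists C|right].
  move=> s Gs sU.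
  (* A finite list contained in the union lies in one member of the chain. *)
  suff [sJ|[C FC sC]] : in_all s J \/ exists2 C, F C & in_all s (C `|` J).
  - exact: GJ sJ.
  - by have [_ /(_ _ Gs)] := FQ _ FC; apply.
  elim: s sU {Gs} => [|x s IH] sU; first by left.
  have Ux := sU x (mem_head _ _).
  have [|sJ|[C FC sC]] := IH.
  - by move=> y ys; apply: sU; rewrite inE ys orbT.
  - case: Ux => [[B FB Bx]|Jx].
      right; exists B => // y; rewrite inE => /predU1P[->|/sJ]; first by left.
      by right.
    by left=> y; rewrite inE => /predU1P[->|/sJ].
  - case: Ux => [[B FB Bx]|Jx].
      have [E [FE BE CE]] := common _ _ FB FC.
      right; exists E => // y; rewrite inE => /predU1P[->|/sC[/CE|]].
      - by left; apply: BE.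
      - by left.
      - by right.
    right; exists C => // y; rewrite inE => /predU1P[->|/sC//]; by right.
set M := A `|` J in M0 MD MM GM.
(* By maximality, the ideal generated by [M] and [x] contains a list of [G]. *)
have grow x : ~ M x -> exists2 s, G s &
    forall a, a \in s -> exists m r, M m /\ a = m + r * x.
  move=> Mx; pose B := [set a | exists m r, M m /\ a = m + r * x].
  have MB : M `<=` B by move=> m Mm; exists m, 0; rewrite mul0r addr0.
  have BJ : B `|` J = B.
    by apply/seteqP; split=> y; [case=> // Jy; apply: MB; right|left].
  have := Amax B; rewrite /Q BJ => /(_ _)/not_andP[].
  - split=> [y Ay|BA]; first by apply: MB; left.
    by apply: Mx; left; apply: BA; exists 0, 1; rewrite mul1r add0r.
  - case; split; first by exists 0, 0; rewrite mul0r addr0.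
      move=> _ _ [m [r [Mm ->]]] [n [q [Mn ->]]]; exists (m + n), (r + q).
      by split; [apply: MD|rewrite mulrDl addrACA].
    move=> a _ [m [r [Mm ->]]]; exists (a * m), (a * r).
    by split; [apply: MM|rewrite mulrDr mulrA].
  - by move/existsNP => [s /not_implyP[Gs /contrapT sB]]; exists s.
have M1 : ~ M 1.
  by move=> M1; apply: (GM _ Gs0) => x _; rewrite -[x]mulr1; apply: MM.
have MI : idealr_closed [in M].
  split; rewrite ?inE //; first by apply/negP; rewrite inE.
  by move=> a x y; rewrite !inE => Mx My; apply: MD => //; apply: MM.
have MP : prime_idealr_closed [in M].
  move=> x y; rewrite inE => Mxy; apply/orP; rewrite !inE.
  apply: contrapT => /not_orP[Mx My].
  have [s Gs sx] := grow _ Mx; have [t Gt ty] := grow _ My.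
  apply: (GM _ (Gmul _ _ Gs Gt)) => _ /allpairsP[[a b] /= [sa tb ->]].
  have [m [r [Mm ->]]] := sx _ sa; have [n [q [Mn ->]]] := ty _ tb.
  have -> : (m + r * x) * (n + q * y) =
      (n + q * y) * m + (r * x) * n + (r * q) * (x * y) by ring.
  by apply: (MD); [apply: (MD)|]; apply: (MM).
by exists (MkSpec MI MP) => //= x Jx; right.
Qed.

(** In the quotient by [C], of dimension zero, the elements
    [b ^+ n * (1 - r * b)] form a multiplicative set.  If it avoided zero, some
    prime [P] over [C] would avoid it; as [P] is maximal and [b] is not in [P],
    some [1 - r * b] would be in [P]. *)
Lemma zero_dim_power (C : set D) (b : D) :
  ideal_or_unit C -> (forall P : Spec D, C `<=` P -> @Max D P) ->
  exists n r, C (b ^+ n * (1 - r * b)).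
Proof.
move=> CI CMax; apply: contrapT => noC.
pose G := [set s | exists n r, s = [:: b ^+ n * (1 - r * b)]].
have [| | | |P CP PG] := @prime_containing_no_list G C.
- by exists [:: b ^+ 0 * (1 - 0 * b)]; exists 0%N, 0.
- move=> _ _ [n [r ->]] [m [q ->]]; exists (n + m)%N, (r + q - r * q * b).
  by rewrite /seq_mul /=; congr [:: _]; rewrite exprD; ring.
- by [].
- move=> _ [n [r ->]] sC; apply: noC; exists n, r; exact: sC (mem_head _ _).
have avoid n r : ~ (P : set D) (b ^+ n * (1 - r * b)).
  move=> Pn; apply: (PG [:: b ^+ n * (1 - r * b)]); first by exists n, r.
  by move=> x; rewrite inE => /eqP->.
have Pb : ~ (P : set D) b by have := avoid 1%N 0; rewrite mul0r subr0 mulr1.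
have [P0 PD PM] := Spec_ideal_or_unit P.
pose J := [set a | exists m r, (P : set D) m /\ a = m + r * b].
have PJ : P `<=` J by move=> m Pm; exists m, 0; rewrite mul0r addr0.
have [m [r [Pm E]]] : J 1.
  apply: contrapT => J1; apply: Pb.
  rewrite -(CMax P CP J) //; first by exists 0, 1; rewrite mul1r add0r.
  split; rewrite ?inE; first exact: PJ.
    by apply/negP; rewrite inE.
  move=> a _ _ /set_mem[m [r [Pm ->]]] /set_mem[n [q [Pn ->]]]; rewrite inE.
  exists (a * m + n), (a * r + q); split; last by ring.
  by apply: PD => //; apply: PM.
by apply: (avoid 0%N r); rewrite expr0 mul1r {1}E addrK.
Qed.

End Primes.

(** * Finitely generated ideals and the inverse topology *)

Definition ideal_span (D : idomainType) (s : seq D) : set D :=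
  [set x | exists c : 'I_(size s) -> D, x = \sum_(i < size s) c i * s`_i].

Lemma ideal_span_ideal (D : idomainType) (s : seq D) : ideal_or_unit (ideal_span s).
Proof.
split; first by exists (fun=> 0); rewrite big1 // => i _; rewrite mul0r.
  move=> _ _ [c ->] [d ->]; exists (fun i => c i + d i).
  by rewrite -big_split; apply: eq_bigr => i _; rewrite mulrDl.
move=> a _ [c ->]; exists (fun i => a * c i).
by rewrite mulr_sumr; apply: eq_bigr => i _; rewrite mulrA.
Qed.

Lemma ideal_span_min (D : idomainType) (s : seq D) (J : set D) :
  ideal_or_unit J -> (ideal_span s `<=` J <-> in_all s J).
Proof.
move=> [J0 JD JM]; split=> [sJ x xs|sJ _ [c ->]].
  apply: sJ; have lt := xs; rewrite -index_mem in lt.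
  exists (fun i => (i == Ordinal lt)%:R).
  rewrite (bigD1 (Ordinal lt)) //= eqxx mul1r nth_index // big1 ?addr0 //.
  move=> i /negPf->.
  by rewrite mul0r.
by elim/big_ind: _ => // i _; apply: JM; apply: sJ; apply: mem_nth.
Qed.

Lemma mem_ideal_span (D : idomainType) (s : seq D) : in_all s (ideal_span s).
Proof. by apply/ideal_span_min => //; apply: ideal_span_ideal. Qed.

(** A finite intersection of subbasic open sets of the inverse topology is itself
    given by a finite list: concatenate lists of generators. *)
Lemma splitting_local (D : idomainType) (X : set (Spec D)) (P : Spec D) :
  splitting_set X -> X P ->
  exists2 s : seq D, in_all s P & forall Q : Spec D, in_all s Q -> X Q.
Proof.
move=> [_ [F FI FX]]; rewrite -FX => -[U FU UP].
have [A AD AE] := FI _ FU.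
have genP (I : set D) : fg_ideal I ->
    exists s : seq D, forall J, ideal_or_unit J -> (I `<=` J <-> in_all s J).
  by move=> [s ->]; exists s; apply: ideal_span_min.
have /choice[g gP] I : exists s : seq D, fg_ideal I ->
    forall J, ideal_or_unit J -> (I `<=` J <-> in_all s J).
  by have [/genP[s sP]|nI] := pselect (fg_ideal I); [exists s|exists [::]].
pose s := flatten [seq g B | B <- enum_fset A].
have sP (Q : Spec D) : in_all s Q <-> U Q.
  have QI := Spec_ideal_or_unit Q.
  rewrite -AE; split=> [sQ I IA|UQ x /flatten_mapP[I IA xI]].
    apply/(gP I _ _ QI); first exact/set_mem/AD.
    by move=> x xI; apply: sQ; apply/flatten_mapP; exists I.
  have fgI : fg_ideal I by apply/set_mem/AD.
  by apply: (gP I fgI _ QI).1 x xI; apply: UQ.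
exists s; first exact/sP.
by move=> Q /sP UQ; exists U.
Qed.

(** * Products and colons of submodules of the quotient field *)

Section Fractional.
Variable D : idomainType.
Local Notation K := {fraction D}.
Local Notation R := (ring_in_frac D).
Implicit Types I J N A B : set K.

Definition submodule J : Prop :=
  [/\ J 0, (forall x y, J x -> J y -> J (x + y)) &
      (forall (a : D) x, J x -> J (tofrac a * x))].

Lemma ring_in_frac_submodule : submodule R.
Proof.
split; first by exists 0; rewrite ?tofrac0.
  by move=> _ _ [a _ <-] [b _ <-]; exists (a + b); rewrite ?tofracD.
by move=> a _ [b _ <-]; exists (a * b); rewrite ?tofracM.
Qed.

Lemma ring_in_frac1 : R 1.
Proof. by exists 1; rewrite ?tofrac1. Qed.

Lemma ring_in_fracM x y : R x -> R y -> R (x * y).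
Proof. by move=> [a _ <-] [b _ <-]; exists (a * b); rewrite ?tofracM. Qed.

Lemma fractionP (x : K) : exists a b : D, b != 0 /\ x = tofrac a / tofrac b.
Proof.
elim/quotW: x => r; exists r.1, r.2; have d0 := denom_ratioP r; split=> //.
apply: (mulIf (x := tofrac r.2)); first by rewrite tofrac_eq0.
rewrite divfK ?tofrac_eq0 //; unlock tofrac.
rewrite -[LHS]pi_mul; apply/eqmodP; rewrite /= equivfE /mulf /=.
rewrite !numden_Ratio ?mulr1 ?oner_neq0 //.
by rewrite mulrC.
Qed.

Lemma fmul_in I J x y : I x -> J y -> fmul I J (x * y).
Proof.
move=> Ix Jy; exists [:: (x, y)]; last by rewrite big_seq1.
by move=> p; rewrite inE => /eqP->.
Qed.

Lemma fmul0 I J : fmul I J 0.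
Proof. by exists [::]; rewrite ?big_nil. Qed.

Lemma fmulD I J x y : fmul I J x -> fmul I J y -> fmul I J (x + y).
Proof.
move=> [s sP ->] [t tP ->]; exists (s ++ t); last by rewrite big_cat.
by move=> p; rewrite mem_cat => /orP[/sP|/tP].
Qed.

(** The universal property of the product: it is the least set closed under
    addition that contains the products, so most inclusions are checked on
    pure products. *)
Lemma fmul_min I J N : N 0 -> (forall x y, N x -> N y -> N (x + y)) ->
  (forall x y, I x -> J y -> N (x * y)) -> fmul I J `<=` N.
Proof.
move=> N0 ND NM _ [s sP ->]; rewrite big_seq; elim/big_ind: _ => // p /sP[Ip Jp].
exact: NM.
Qed.

Lemma fmulC I J : fmul I J = fmul J I.
Proof.
suff H A B : fmul A B `<=` fmul B A by apply/seteqP; split; apply: H.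
apply: fmul_min; [exact: fmul0|exact: fmulD|] => x y Ax By.
by rewrite mulrC; apply: fmul_in.
Qed.

Lemma fmulA I J N : fmul I (fmul J N) = fmul (fmul I J) N.
Proof.
suff H A B C : fmul A (fmul B C) `<=` fmul (fmul A B) C.
  apply/seteqP; split; first exact: H.
  by rewrite fmulC (fmulC I J) (fmulC I) (fmulC J N); apply: H.
apply: fmul_min; [exact: fmul0|exact: fmulD|] => x y Ax.
apply: (@fmul_min _ _ [set y | fmul (fmul A B) C (x * y)]) => {y} /=.
- by rewrite mulr0; apply: fmul0.
- by move=> y z; rewrite mulrDr; apply: fmulD.
- by move=> y z By Cz; rewrite mulrA; apply: fmul_in => //; apply: fmul_in.
Qed.

Lemma fmul_submodule I J : submodule I -> submodule (fmul I J).
Proof.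
move=> [_ _ IM]; split; [exact: fmul0|exact: fmulD|] => a.
apply: (@fmul_min _ _ [set x | fmul I J (tofrac a * x)]) => /=.
- by rewrite mulr0; apply: fmul0.
- by move=> y z; rewrite mulrDr; apply: fmulD.
- by move=> y z Iy Jz; rewrite mulrA; apply: fmul_in => //; apply: IM.
Qed.

Lemma fmul_one I : submodule I -> fmul R I = I.
Proof.
move=> [I0 ID IM]; apply/seteqP; split; last first.
  by move=> x Ix; rewrite -[x]mul1r; apply: fmul_in => //; apply: ring_in_frac1.
by apply: fmul_min => // _ y [a _ <-]; apply: IM.
Qed.

Lemma fmulS I J A B : I `<=` A -> J `<=` B -> fmul I J `<=` fmul A B.
Proof.
move=> IA JB; apply: fmul_min; [exact: fmul0|exact: fmulD|] => x y /IA Ax /JB By.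
exact: fmul_in.
Qed.

Lemma fcolon_submodule I : submodule (fcolon I).
Proof.
have [R0 RD RM] := ring_in_frac_submodule.
split; first by move=> y _; rewrite mul0r.
  by move=> x y Ix Iy z Iz; rewrite mulrDl; apply: RD; [apply: Ix|apply: Iy].
by move=> a x Ix z Iz; rewrite -mulrA; apply/RM/Ix.
Qed.

Lemma fcolonS I J : I `<=` J -> fcolon J `<=` fcolon I.
Proof. by move=> IJ x Jx y /IJ; apply: Jx. Qed.

Lemma vclosure_ge I : I `<=` vclosure I.
Proof. by move=> x Ix y; rewrite mulrC; apply. Qed.

Lemma vclosureS I J : I `<=` J -> vclosure I `<=` vclosure J.
Proof. by move=> IJ; apply/fcolonS/fcolonS. Qed.

Lemma fcolon_vclosure I : fcolon (vclosure I) = fcolon I.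
Proof.
apply/seteqP; split; first exact/fcolonS/vclosure_ge.
exact: (@vclosure_ge (fcolon I)).
Qed.

Lemma divisorial_fcolon I : divisorial (fcolon I).
Proof. exact/esym/fcolon_vclosure. Qed.

Lemma fcolon_fmulE I J x :
  fcolon (fmul I J) x <-> forall y z, I y -> J z -> R (x * (y * z)).
Proof.
have [R0 RD RM] := ring_in_frac_submodule.
split=> [H y z Iy Jz|H]; first by apply: H; apply: fmul_in.
apply: (@fmul_min _ _ [set y | R (x * y)]) => //=; first by rewrite mulr0.
by move=> y z; rewrite mulrDr; apply: RD.
Qed.

(** An element [x] is in the colon of [I J] iff [x I] is contained in the colon of
    [J], and [J] has the same colon as its v-closure.  The associativity of the
    v-product rests on this. *)
Lemma fcolon_fmul_vclosure I J : fcolon (fmul I (vclosure J)) = fcolon (fmul I J).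
Proof.
apply/seteqP; split; first exact/fcolonS/fmulS/vclosure_ge.
move=> x /fcolon_fmulE H; apply/fcolon_fmulE => y z Iy Jz.
rewrite mulrA mulrC; apply: Jz => t Jt; rewrite -mulrA; exact: H.
Qed.

Lemma vmul_vclosure I J : vmul I (vclosure J) = vmul I J.
Proof. by rewrite /vmul /vclosure -/(vclosure J) fcolon_fmul_vclosure. Qed.

Lemma vmulC I J : vmul I J = vmul J I.
Proof. by rewrite /vmul fmulC. Qed.

Lemma vmulA I J N : vmul I (vmul J N) = vmul (vmul I J) N.
Proof.
have E A B C : vmul A (vmul B C) = vclosure (fmul A (fmul B C)).
  exact: vmul_vclosure.
by rewrite (vmulC (vmul I J)) !E (fmulC N) fmulA.
Qed.

Lemma vmul_one I : submodule I -> divisorial I -> vmul R I = I.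
Proof. by move=> SI dI; rewrite /vmul fmul_one. Qed.

Lemma vmulS I J A B : I `<=` A -> J `<=` B -> vmul I J `<=` vmul A B.
Proof. by move=> IA JB; apply/vclosureS/fmulS. Qed.

Lemma fractional_submodule I : fractional_ideal I -> submodule I.
Proof. by case. Qed.

Lemma fractional_int I : fractional_ideal I -> exists2 d : D, d != 0 & I (tofrac d).
Proof.
move=> [_ _ IM [x Ix x0] _]; have [a [b [b0 E]]] := fractionP x; exists a.
  by apply: contra x0 => /eqP a0; rewrite E a0 tofrac0 mul0r.
have -> : tofrac a = tofrac b * x by rewrite E mulrCA divff ?mulr1 ?tofrac_eq0.
exact: IM.
Qed.

Lemma fractional_sandwich A B J : fractional_ideal A -> fractional_ideal B ->
  submodule J -> A `<=` J -> J `<=` B -> fractional_ideal J.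
Proof.
move=> [_ _ _ [x Ax x0] _] [_ _ _ _ [d d0 dB]] [J0 JD JM] AJ JB; split=> //.
  by exists x => //; apply: AJ.
by exists d => // y /JB; apply: dB.
Qed.

Lemma fractional_ring : fractional_ideal R.
Proof.
have [R0 RD RM] := ring_in_frac_submodule; split=> //.
  by exists 1; [exact: ring_in_frac1|exact: oner_neq0].
by exists 1; [exact: oner_neq0|move=> x Rx; apply: RM].
Qed.

Lemma fractional_fcolon I : fractional_ideal I -> fractional_ideal (fcolon I).
Proof.
move=> FI; have [c0 cD cM] := fcolon_submodule I.
have [a a0 Ia] := fractional_int FI; have [_ _ _ _ [d d0 dI]] := FI; split=> //.
  by exists (tofrac d); rewrite ?tofrac_eq0.
by exists a => // x; rewrite mulrC; apply.
Qed.

Lemma fractional_vclosure I : fractional_ideal I -> fractional_ideal (vclosure I).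
Proof. by move=> FI; do 2 apply: fractional_fcolon. Qed.

Lemma fractional_fmul I J :
  fractional_ideal I -> fractional_ideal J -> fractional_ideal (fmul I J).
Proof.
move=> FI FJ; have [F0 FD FM] := fmul_submodule J (fractional_submodule FI).
have [_ _ _ [x Ix x0] [d d0 dI]] := FI; have [_ _ _ [y Jy y0] [e e0 eJ]] := FJ.
split=> //; first by exists (x * y); [apply: fmul_in|rewrite mulf_neq0].
have [R0 RD RM] := ring_in_frac_submodule.
exists (d * e); first by rewrite mulf_neq0.
apply: (@fmul_min _ _ [set z | R (tofrac (d * e) * z)]) => /=.
- by rewrite mulr0.
- by move=> u v; rewrite mulrDr; apply: RD.
- move=> u v Iu Jv; rewrite tofracM mulrACA.
  by apply: ring_in_fracM; [apply: dI|apply: eJ].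
Qed.

Lemma fractional_vmul I J :
  fractional_ideal I -> fractional_ideal J -> fractional_ideal (vmul I J).
Proof. by move=> FI FJ; apply/fractional_vclosure/fractional_fmul. Qed.

(** * The groups of invertible and of v-invertible ideals *)

Lemma fmul_fcolon_le I : fmul I (fcolon I) `<=` R.
Proof.
have [R0 RD RM] := ring_in_frac_submodule; apply: fmul_min => // x y Ix.
by rewrite mulrC; apply.
Qed.

Lemma invertible_fcolon I : invertible I -> fmul I (fcolon I) = R.
Proof.
move=> [J FJ IJ]; apply/seteqP; split; first exact: fmul_fcolon_le.
rewrite -IJ; apply: fmulS => // y Jy x Ix.
by rewrite -IJ mulrC; apply: fmul_in.
Qed.

Lemma Inv_fcolon I : Inv I -> Inv (fcolon I).
Proof.
move=> [FI II]; split; first exact: fractional_fcolon.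
by exists I => //; rewrite fmulC invertible_fcolon.
Qed.

(** If [x (D : I)] is contained in [D], then
    [x D = x (D : I) I] is contained in [I]. *)
Lemma Inv_divisorial I : Inv I -> divisorial I.
Proof.
move=> [FI II]; apply/seteqP; split; first exact: vclosure_ge.
move=> x Ix; have [I0 ID IM] := fractional_submodule FI.
suff H : fmul I (fcolon I) `<=` [set y | I (x * y)].
  by rewrite -[x]mulr1; apply: H; rewrite invertible_fcolon //; apply: ring_in_frac1.
apply: fmul_min => /= [|y z|y z Iy cz].
- by rewrite mulr0.
- by rewrite mulrDr; apply: ID.
- by have [a _ E] := Ix z cz; rewrite (mulrC y) mulrA -E; apply: IM.
Qed.

Lemma Inv_ring : Inv R.
Proof.
split; first exact: fractional_ring; exists R; first exact: fractional_ring.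
exact/fmul_one/ring_in_frac_submodule.
Qed.

Lemma Inv_fmul I J : Inv I -> Inv J -> Inv (fmul I J).
Proof.
move=> [FI [I' FI' EI]] [FJ [J' FJ' EJ]]; split; first exact: fractional_fmul.
exists (fmul I' J'); first exact: fractional_fmul.
rewrite -fmulA (fmulA J) (fmulC J) -fmulA EJ fmulA EI fmul_one //.
exact: ring_in_frac_submodule.
Qed.

Lemma Inv_vmul I J : Inv I -> Inv J -> vmul I J = fmul I J.
Proof. by move=> II IJ; apply/esym/Inv_divisorial/Inv_fmul. Qed.

Lemma Inv_Div : @Inv D `<=` @Div D.
Proof.
move=> I II; have [FI [J FJ IJ]] := II; split=> //; first exact: Inv_divisorial.
exists J => //; rewrite /vmul IJ; exact/esym/Inv_divisorial/Inv_ring.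
Qed.

(** Any v-inverse of [I] is contained in [(D : I)], so [(D : I)] is one too. *)
Lemma vmul_fcolon I : v_invertible I -> vmul I (fcolon I) = R.
Proof.
move=> [J FJ IJ]; apply/seteqP; split.
  rewrite (Inv_divisorial Inv_ring); exact/vclosureS/fmul_fcolon_le.
rewrite -IJ; apply: vmulS => // y Jy x Ix.
by rewrite -IJ mulrC; apply/vclosure_ge/fmul_in.
Qed.

Lemma Div_fcolon I : Div I -> Div (fcolon I).
Proof.
move=> [FI dI vI]; split; [exact: fractional_fcolon|exact: divisorial_fcolon|].
by exists I => //; rewrite vmulC vmul_fcolon.
Qed.

Lemma Div_vmul I J : Div I -> Div J -> Div (vmul I J).
Proof.
move=> DI DJ; have [[FI dI vI] [FJ dJ vJ]] := (DI, DJ).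
have [[FI' dI' _] [FJ' dJ' _]] := (Div_fcolon DI, Div_fcolon DJ).
split; [exact: fractional_vmul|exact: divisorial_fcolon|].
exists (vmul (fcolon I) (fcolon J)); first exact: fractional_vmul.
rewrite -vmulA (vmulA J) (vmulC J) -vmulA vmul_fcolon //.
rewrite vmulA vmul_fcolon // vmul_one //; first exact: ring_in_frac_submodule.
by case: (Inv_Div Inv_ring).
Qed.

Lemma Inv_ordered_group : ordered_group (Inv_group D).
Proof.
split=> /=.
- exact: Inv_fmul.
- exact: Inv_ring.
- by move=> a b c _ _ _; apply: fmulA.
- by move=> a [/fractional_submodule Sa _]; apply: fmul_one.
- by move=> a [/fractional_submodule Sa _]; rewrite fmulC; apply: fmul_one.
- move=> a Ia; exists (fcolon a).
  rewrite (fmulC (fcolon a)) invertible_fcolon; last by case: Ia.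
  by split=> //; apply: Inv_fcolon.
- by move=> a _.
- by move=> a b _ _ ba ab; apply/seteqP; split.
- by move=> a b c _ _ _ ba cb x /cb/ba.
- by move=> a b c _ _ _ ba; split; apply: fmulS.
Qed.

Lemma Div_ordered_group : ordered_group (Div_group D).
Proof.
split=> /=.
- exact: Div_vmul.
- exact/Inv_Div/Inv_ring.
- by move=> a b c _ _ _; apply: vmulA.
- by move=> a [/fractional_submodule Sa da _]; apply: vmul_one.
- by move=> a [/fractional_submodule Sa da _]; rewrite vmulC; apply: vmul_one.
- move=> a Da; exists (fcolon a).
  rewrite (vmulC (fcolon a)) vmul_fcolon; last by case: Da.
  by split=> //; apply: Div_fcolon.
- by move=> a _.
- by move=> a b _ _ ba ab; apply/seteqP; split.
- by move=> a b c _ _ _ ba cb x /cb/ba.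
- by move=> a b c _ _ _ ba; split; apply: vmulS.
Qed.

End Fractional.

Lemma ordered_group_restrict T (G : pogroup_data T) (H : set T) :
  ordered_group G -> subgroup G H -> ordered_group (pog_restrict G H).
Proof.
move=> [Gmul G1 GA G1m Gm1 Ginv Grefl Ganti Gtrans Gle] [HG H1 Hmul Hinv].
split=> //=.
- by move=> a b c /HG Ga /HG Gb /HG Gc; apply: GA.
- by move=> a /HG; apply: G1m.
- by move=> a /HG; apply: Gm1.
- move=> a Ha; have Ga := HG _ Ha; have [b Hb ab] := Hinv _ Ha; have Gb := HG _ Hb.
  have [c [Gc ac ca]] := Ginv _ Ga; exists b; split=> //.
  have -> : b = c by rewrite -[LHS]G1m // -ca -GA // ab Gm1.
  exact: ca.
- by move=> a /HG; apply: Grefl.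
- by move=> a b /HG Ga /HG Gb; apply: Ganti.
- by move=> a b c /HG Ga /HG Gb /HG Gc; apply: Gtrans.
- by move=> a b c /HG Ga /HG Gb /HG Gc; apply: Gle.
Qed.


(** * Finitely generated fractional ideals of a Prufer domain *)

Section Prufer.
Variable D : idomainType.
Local Notation K := {fraction D}.
Local Notation R := (ring_in_frac D).
Implicit Types (I J N A B : set K) (s : seq K).

Lemma common_denominator s :
  exists2 d : D, d != 0 & forall x, x \in s -> R (tofrac d * x).
Proof.
have [R0 RD RM] := ring_in_frac_submodule D.
elim: s => [|x s [d d0 ds]]; first by exists 1; rewrite ?oner_neq0.
have [a [b [b0 E]]] := fractionP x.
exists (b * d); first by rewrite mulf_neq0.
move=> y; rewrite inE tofracM => /predU1P[->|/ds].
  by rewrite mulrAC E mulrCA divff ?tofrac_eq0 // mulr1 -tofracM; exists (a * d).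
by rewrite -mulrA; apply: RM.
Qed.

(** After clearing the denominators of [s], the span becomes a finitely generated
    ideal of [D].  Its span in the quotient field is then
    recovered by dividing by the common denominator. *)
Lemma prufer_span s : prufer D -> (exists2 x, x \in s & x != 0) ->
  exists N, [/\ Inv N, (forall x, x \in s -> N x) &
    forall M, submodule M -> (forall x, x \in s -> M x) -> N `<=` M].
Proof.
move=> hD [x0 x0s x00]; have [d d0 ds] := common_denominator s.
have df : tofrac d != 0 by rewrite tofrac_eq0.
have /choice[num numP] x : exists a : D, x \in s -> tofrac d * x = tofrac a.
  by have [/ds[a _ E]|_] := boolP (x \in s); [exists a|exists 0].
pose t := [seq num x | x <- s].
have [t0 tD tM] := ideal_span_ideal t.
pose I := @tofrac D @` ideal_span t; pose N := [set x | I (tofrac d * x)].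
have NI a : ideal_span t a -> N (tofrac a / tofrac d).
  by move=> ta; rewrite /N /= mulrCA divff // mulr1; exists a.
have Ns x : x \in s -> N x.
  move=> xs; rewrite /N /= numP //; exists (num x) => //.
  by apply/mem_ideal_span/map_f.
have NS : submodule N.
  split; rewrite /N /=; first by exists 0; rewrite ?tofrac0 ?mulr0.
    move=> x y [a ta Ea] [b tb Eb]; exists (a + b); first exact: tD.
    by rewrite tofracD Ea Eb mulrDr.
  move=> c x [a ta Ea]; exists (c * a); first exact: tM.
  by rewrite tofracM Ea mulrCA.
have [N0 ND NM] := NS.
have NF : fractional_ideal N.
  split=> //; first by exists x0 => //; apply: Ns.
  by exists d => // x [a _ <-]; exists a.
exists N; split=> //.
  split=> //; exists (fcolon N); first exact: fractional_fcolon.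
  apply/seteqP; split; first exact: fmul_fcolon_le.
  have [J IJ] : exists J, fmul I J = R.
    have [||J _ IJ] := hD (ideal_span t); [by exists t| |by exists J].
    move=> E; have : ideal_span t (num x0) by apply/mem_ideal_span/map_f.
    rewrite E /= => num0; have := mulf_neq0 df x00.
    by rewrite numP // num0 tofrac0 eqxx.
  rewrite -IJ; apply: fmul_min; [exact: fmul0|exact: fmulD|] => _ y [a ta <-] Jy.
  have -> : tofrac a * y = (tofrac a / tofrac d) * (tofrac d * y).
    by rewrite mulrA divfK.
  apply: fmul_in; first exact: NI.
  by move=> x Nx; rewrite mulrAC -IJ; apply: fmul_in.
move=> M [M0 MD MM] sM x [a ta Ea].
have -> : x = tofrac a / tofrac d by rewrite Ea mulrAC divff ?mul1r.
have MI : ideal_or_unit [set a | M (tofrac a / tofrac d)].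
  split=> /=; first by rewrite tofrac0 mul0r.
    by move=> b c; rewrite tofracD mulrDl; apply: MD.
  by move=> b c; rewrite tofracM -mulrA; apply: MM.
apply: (ideal_span_min _ MI).2 ta => _ /mapP[y ys ->] /=.
by rewrite -numP // mulrAC divff ?mul1r //; apply: sM.
Qed.

(** Writing 1 as a sum of products [a b] with [a] in [A] and [b] in [(D : A)], the
    elements [a] generate [A]. *)
Lemma Inv_fg A : Inv A -> exists2 s : seq K, (forall x : K, x \in s -> A x) &
  forall M, submodule M -> (forall x : K, x \in s -> M x) -> A `<=` M.
Proof.
move=> [FA IA]; have [s sA E1] : fmul A (fcolon A) 1.
  by rewrite invertible_fcolon //; apply: ring_in_frac1.
exists [seq p.1 | p <- s] => [_ /mapP[p /sA[Ap _] ->] //|M [M0 MD MM] sM x Ax].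
rewrite -[x]mulr1 E1 mulr_sumr big_seq; elim/big_ind: _ => // p ps.
have [_ /(_ x Ax)[a _ Ea]] := sA p ps.
by rewrite mulrCA (mulrC x) -Ea mulrC; apply/MM/sM/map_f.
Qed.

Lemma Inv_adjoin A s : prufer D -> Inv A ->
  exists N, [/\ Inv N, A `<=` N, (forall x, x \in s -> N x) &
    forall M, submodule M -> A `<=` M -> (forall x, x \in s -> M x) -> N `<=` M].
Proof.
move=> hD IA; have [t tA Amin] := Inv_fg IA; have [[_ _ _ [x Ax x0] _] _] := IA.
have [|N [IN sN Nmin]] := @prufer_span (x :: t ++ s) hD.
  by exists x; rewrite ?mem_head.
have [FN _] := IN; exists N; split=> //.
- apply: Amin; first exact: fractional_submodule.
  by move=> y yt; apply: sN; rewrite inE mem_cat yt orbT.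
- by move=> y ys; apply: sN; rewrite inE mem_cat ys !orbT.
- move=> M SM AM sM; apply: Nmin => // y; rewrite inE mem_cat.
  by case/predU1P=> [->|/orP[/tA/AM|/sM]//]; apply: AM.
Qed.

Lemma Inv_join A B : prufer D -> Inv A -> Inv B ->
  exists N, [/\ Inv N, A `<=` N, B `<=` N &
    forall M, submodule M -> A `<=` M -> B `<=` M -> N `<=` M].
Proof.
move=> hD IA IB; have [s sB Bmin] := Inv_fg IB.
have [N [IN AN sN Nmin]] := Inv_adjoin s hD IA; have [FN _] := IN.
exists N; split=> //; first by apply: Bmin => //; apply: fractional_submodule.
by move=> M SM AM BM; apply: Nmin => // x /sB/BM.
Qed.

End Prufer.

(** * Complete integral closedness *)

(** Locally, an element [x] outside a valuation ring [V] whose powers have a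
    common denominator [c] yields a nonmaximal prime that contains [c], the
    intersection of the ideals [x ^- n V].  The proof avoids localization: the
    role of the valuation is played by [1 = u + x v], which says that the ideal
    spanned by 1 and [x] is invertible. *)
Lemma almost_integral (D : idomainType) (x : {fraction D}) : prufer D ->
  (forall P : Spec D,
     [set c : D | forall n, ring_in_frac D (x ^+ n * tofrac c)] `<=` P ->
     @Max D P) ->
  ring_in_frac D x.
Proof.
move=> hD CMax; set C := [set c | _] in CMax.
have [R0 RD RM] := ring_in_frac_submodule D; have RMM := @ring_in_fracM D.
have RN y : ring_in_frac D y -> ring_in_frac D (- y).
  by move=> /(RM (-1)); rewrite tofracN tofrac1 mulN1r.
have CI : ideal_or_unit C.
  split=> [n|a b Ca Cb n|a b Cb n]; first by rewrite tofrac0 mulr0.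
    by rewrite tofracD mulrDr; apply: RD.
  by rewrite tofracM mulrCA; apply/RM/Cb.
have [u [v [Ru Rux [w _ Ew] Rvx E1]]] : exists u v : {fraction D},
    [/\ ring_in_frac D u, ring_in_frac D (u * x), ring_in_frac D v,
        ring_in_frac D (v * x) & 1 = u + x * v].
  have [|N [[_ IN] sN Nmin]] := @prufer_span D [:: 1; x] hD.
    by exists 1; rewrite ?mem_head ?oner_neq0.
  have N1 : N 1 by apply: sN; rewrite mem_head.
  have Nx : N x by apply: sN; rewrite !inE eqxx orbT.
  have [c0 cD cM] := fcolon_submodule N.
  (* [T] is the sum of [(D : N)] and [x (D : N)], for [N] the span of 1 and [x]. *)
  pose T := [set z | exists u v, [/\ fcolon N u, fcolon N v & z = u + x * v]].
  have TD y z : T y -> T z -> T (y + z).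
    move=> [u [v [cu cv ->]]] [u' [v' [cu' cv' ->]]]; exists (u + u'), (v + v').
    by split; [apply: cD|apply: cD|rewrite mulrDr addrACA].
  have T0 : T 0 by exists 0, 0; rewrite mulr0 addr0.
  have [u [v [cu cv E]]] : T 1.
    suff NT : fmul N (fcolon N) `<=` T.
      by apply: NT; rewrite invertible_fcolon //; apply: ring_in_frac1.
    apply: fmul_min => // y z Ny cz; apply: (Nmin [set y | T (y * z)]) y Ny.
      split=> /= [|y y'|a y [u [v [cu cv Ey]]]]; first by rewrite mul0r.
        by rewrite mulrDl; apply: TD.
      exists (tofrac a * u), (tofrac a * v); split; [exact: cM|exact: cM|].
      by rewrite -mulrA Ey mulrDr mulrCA.
    move=> y; rewrite !inE => /orP[] /eqP-> /=.
      by exists z, 0; rewrite mul1r mulr0 addr0.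
    by exists 0, z; rewrite add0r.
  exists u, v; split=> //; [|exact: cu| |exact: cv].
    by rewrite -[u]mulr1; apply: cu.
  by rewrite -[v]mulr1; apply: cv.
have [n [r Cnr]] := zero_dim_power w CI CMax.
have Eu : x * v = 1 - u by rewrite E1 addrAC subrr add0r.
have R1u : ring_in_frac D (1 - u) by apply: RD; [apply: ring_in_frac1|apply: RN].
have R1un m : ring_in_frac D ((1 - u) ^+ m).
  by elim: m => [|m IH]; [apply: ring_in_frac1|rewrite exprS; apply: RMM].
have Rdiff m : ring_in_frac D ((1 - u) ^+ m * x - x).
  elim: m => [|m IH]; first by rewrite expr0 mul1r subrr.
  have -> : (1 - u) ^+ m.+1 * x - x =
      ((1 - u) ^+ m * x - x) + - ((1 - u) ^+ m * (u * x)) by rewrite exprS; ring.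
  by apply: RD => //; apply: RN; apply: RMM.
have := Cnr n.+1; rewrite tofracM tofracXn tofracB tofrac1 tofracM Ew => Rn.
(* The first term is [(1 - u) ^+ n * (1 - r v) * x]. *)
have -> : x = x ^+ n.+1 * (v ^+ n * (1 - tofrac r * v)) + tofrac r * (v * x) -
    (1 - tofrac r * v) * ((1 - u) ^+ n * x - x).
  by rewrite -Eu exprS exprMn; ring.
apply: (RD); first by apply: (RD) => //; apply: (RM).
apply: (RN); apply: (RMM) => //; apply: (RD); first exact: ring_in_frac1.
by apply: (RN); apply: (RM); rewrite -Ew; exists w.
Qed.

(** * Supports *)

Section Support.
Variables (D : idomainType) (X : set (Spec D)).
Local Notation K := {fraction D}.
Local Notation R := (ring_in_frac D).
Implicit Types (I J N A B : set K) (P : Spec D).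

Lemma Spec_neq0 P (t : D) : ~ (P : set D) t -> tofrac t != 0.
Proof.
move=> Pt; rewrite tofrac_eq0; apply: contra_notN Pt => /eqP->.
by case: (Spec_ideal_or_unit P).
Qed.

Lemma localizationE P x :
  localization P x <-> exists2 t : D, ~ (P : set D) t & R (tofrac t * x).
Proof.
split=> [[a [t [Pt ->]]]|[t Pt [a _ E]]].
  by exists t => //; rewrite mulrCA divff ?mulr1 ?(Spec_neq0 Pt) //; exists a.
by exists a, t; split=> //; rewrite E mulrAC divff ?mul1r ?(Spec_neq0 Pt).
Qed.

Lemma ring_localization P : R `<=` localization P.
Proof.
move=> x Rx; apply/localizationE; exists 1; first exact: Spec_proper.
by rewrite tofrac1 mul1r.
Qed.

Lemma localization_submodule P : submodule (localization P).
Proof.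
have [R0 RD RM] := ring_in_frac_submodule D.
split; first exact: ring_localization.
  move=> x y /localizationE[t Pt Rt] /localizationE[u Pu Ru]; apply/localizationE.
  exists (t * u); first exact: Spec_mul_notin.
  by rewrite tofracM mulrDr {1}(mulrC (tofrac t)) -!mulrA; apply: RD; apply: RM.
move=> a x /localizationE[t Pt Rt]; apply/localizationE; exists t => //.
by rewrite mulrCA; apply: RM.
Qed.

Lemma localizationM P x y :
  localization P x -> localization P y -> localization P (x * y).
Proof.
move=> /localizationE[t Pt Rt] /localizationE[u Pu Ru]; apply/localizationE.
exists (t * u); first exact: Spec_mul_notin.
by rewrite tofracM mulrACA; apply: ring_in_fracM.
Qed.

(** Outside [X], the localization of [J] is that of [D]; see [supp_sub].  The
    condition that [J] contains 1 locally is expressed by an element of [J]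
    outside [P]. *)
Definition trivial_off J : Prop := forall P, ~ X P ->
  (exists2 t : D, ~ (P : set D) t & J (tofrac t)) /\ J `<=` localization P.

Lemma supp_sub J : submodule J -> (supp J `<=` X <-> trivial_off J).
Proof.
move=> [J0 JD JM]; split=> [sX P XP|tX P sP].
  have E : fmul J (localization P) = localization P.
    by apply: contrapT => nE; apply: XP; apply: sX.
  have L1 : localization P 1 by apply/ring_localization/ring_in_frac1.
  split; last by rewrite -E => x Jx; rewrite -[x]mulr1; apply: fmul_in.
  suff H : fmul J (localization P) `<=`
      [set x | exists2 t : D, ~ (P : set D) t & J (tofrac t * x)].
    by move: L1; rewrite -E => /H[t Pt]; rewrite mulr1; exists t.
  apply: fmul_min => [|x y [t Pt Jt] [u Pu Ju]|x y Jx /localizationE[t Pt [a _ Ea]]].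
  - by exists 1; [apply: Spec_proper|rewrite mulr0].
  - exists (t * u); first exact: Spec_mul_notin.
    rewrite tofracM mulrDr {1}(mulrC (tofrac t)) -!mulrA.
    by apply: JD; apply: JM.
  - by exists t => //; rewrite mulrCA -Ea mulrC; apply: JM.
apply: contrapT => XP; apply: sP; have [[t Pt Jt] JL] := tX P XP.
have [L0 LD LM] := localization_submodule P.
apply/seteqP; split=> [|y Ly].
  by apply: fmul_min => // x y /JL; apply: localizationM.
have -> : y = tofrac t * (y / tofrac t).
  by rewrite mulrCA divff ?mulr1 ?(Spec_neq0 Pt).
apply: fmul_in => //; apply: localizationM => //.
by exists 1, t; rewrite tofrac1 mul1r.
Qed.

Lemma trivial_off_sandwich A B J :
  trivial_off A -> trivial_off B -> A `<=` J -> J `<=` B -> trivial_off J.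
Proof.
move=> tA tB AJ JB P XP; have [[t Pt At] _] := tA P XP; have [_ BL] := tB P XP.
by split; [exists t => //; apply: AJ|move=> x /JB/BL].
Qed.

Lemma trivial_off_ring : trivial_off R.
Proof.
move=> P _; split; last exact: ring_localization.
by exists 1; [apply: Spec_proper|exists 1].
Qed.

Lemma trivial_off_fmul A B : trivial_off A -> trivial_off B -> trivial_off (fmul A B).
Proof.
move=> tA tB P XP; have [[t Pt At] AL] := tA P XP; have [[u Pu Bu] BL] := tB P XP.
split.
  by exists (t * u); [apply: Spec_mul_notin|rewrite tofracM; apply: fmul_in].
have [L0 LD LM] := localization_submodule P.
by apply: fmul_min => // x y /AL Lx /BL; apply: localizationM.
Qed.

(** An element of [I] outside [P] is a denominator for all of [(D : I)].  In the
    other direction, 1 is a sum of products from [I] and [(D : I)]; denominators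
    of the factors from [I] turn it into an element of [(D : I)]. *)
Lemma trivial_off_fcolon I : Inv I -> trivial_off I -> trivial_off (fcolon I).
Proof.
move=> [FI II] tI P XP; have [[t Pt It] IL] := tI P XP; split; last first.
  by move=> x cx; apply/localizationE; exists t => //; rewrite mulrC; apply: cx.
have [c0 cD cM] := fcolon_submodule I.
suff H : fmul I (fcolon I) `<=`
    [set x | exists2 t : D, ~ (P : set D) t & fcolon I (tofrac t * x)].
  have /H[u Pu] : fmul I (fcolon I) 1.
    by rewrite invertible_fcolon //; apply: ring_in_frac1.
  by rewrite mulr1; exists u.
apply: fmul_min => [|x y [u Pu cu] [v Pv cv]|x y /IL/localizationE[u Pu [a _ Ea]] cy].
- by exists 1; [apply: Spec_proper|rewrite mulr0].
- exists (u * v); first exact: Spec_mul_notin.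
  rewrite tofracM mulrDr {1}(mulrC (tofrac u)) -!mulrA.
  by apply: cD; apply: cM.
- by exists u => //; rewrite mulrA -Ea; apply: cM.
Qed.

Lemma Inv_onE I : Inv_on X I <-> Inv I /\ trivial_off I.
Proof.
by split=> -[II sI]; (split; first done);
  have [/fractional_submodule/supp_sub FI _] := II; apply/FI.
Qed.

Lemma Inv_on_ring : Inv_on X R.
Proof. by apply/Inv_onE; split; [exact: Inv_ring|exact: trivial_off_ring]. Qed.

Lemma Inv_on_fmul A B : Inv_on X A -> Inv_on X B -> Inv_on X (fmul A B).
Proof.
move=> /Inv_onE[IA tA] /Inv_onE[IB tB]; apply/Inv_onE.
by split; [exact: Inv_fmul|exact: trivial_off_fmul].
Qed.

Lemma Inv_on_fcolon I : Inv_on X I -> Inv_on X (fcolon I).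
Proof.
move=> /Inv_onE[II tI]; apply/Inv_onE.
by split; [exact: Inv_fcolon|exact: trivial_off_fcolon].
Qed.

Lemma Inv_on_sandwich A B I :
  Inv_on X A -> Inv_on X B -> Inv I -> A `<=` I -> I `<=` B -> Inv_on X I.
Proof.
move=> /Inv_onE[_ tA] /Inv_onE[_ tB] II AI IB; apply/Inv_onE; split=> //.
exact: trivial_off_sandwich AI IB.
Qed.

Lemma Inv_on_subgroup : subgroup (Inv_group D) (Inv_on X).
Proof.
split=> /=; [by move=> I []|exact: Inv_on_ring|exact: Inv_on_fmul|].
move=> I XI; exists (fcolon I); first exact: Inv_on_fcolon.
by have [[_ II] _] := XI; apply: invertible_fcolon.
Qed.

Lemma Inv_on_join A B : prufer D -> Inv_on X A -> Inv_on X B ->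
  exists N, [/\ Inv_on X N, A `<=` N, B `<=` N &
    forall M, submodule M -> A `<=` M -> B `<=` M -> N `<=` M].
Proof.
move=> hD /Inv_onE[IA tA] /Inv_onE[IB tB].
have [N [IN AN BN Nmin]] := Inv_join hD IA IB.
exists N; split=> //; apply/Inv_onE; split=> // P XP.
have [[[t Pt At] AL] [_ BL]] := (tA P XP, tB P XP).
split; first by exists t => //; apply: AN.
by apply: Nmin => //; apply: localization_submodule.
Qed.

(** [A] and [B] are the colons of their inverses, so their intersection is the
    colon of the sum of these inverses. *)
Lemma Inv_on_meet A B : prufer D -> Inv_on X A -> Inv_on X B -> Inv_on X (A `&` B).
Proof.
move=> hD XA XB; have [[IA _] [IB _]] := (XA, XB).
have [N [XN AN BN Nmin]] := Inv_on_join hD (Inv_on_fcolon XA) (Inv_on_fcolon XB).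
suff -> : A `&` B = fcolon N by apply: Inv_on_fcolon.
apply/seteqP; split; last first.
  rewrite {1}(Inv_divisorial IA) {1}(Inv_divisorial IB) => x Nx.
  by split; apply: fcolonS Nx.
move=> x [Ax Bx] y; rewrite mulrC.
have SM : submodule [set y | R (y * x)].
  have [R0 RD RM] := ring_in_frac_submodule D.
  split=> /=; first by rewrite mul0r.
    by move=> u v; rewrite mulrDl; apply: RD.
  by move=> a u; rewrite -mulrA; apply: RM.
by apply: Nmin SM _ _ y => z; apply.
Qed.

End Support.

(** * Bounding divisorial ideals by invertible ones *)

Section Splitting.
Variables (D : idomainType) (X : set (Spec D)).
Hypotheses (hD : prufer D) (hX : X `<=` @Max D) (hsplit : splitting_set X).
Local Notation K := {fraction D}.
Local Notation R := (ring_in_frac D).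
Implicit Types (I J N A B : set K) (P : Spec D).

(** Openness of [X] enters here: a prime over the integral part of [J] is in [X],
    so it contains a list of [G]. *)
Lemma Inv_on_below J : fractional_ideal J -> supp J `<=` X ->
  exists2 A, Inv_on X A & A `<=` J.
Proof.
move=> FJ sX; have SJ := fractional_submodule FJ; have [J0 JD JM] := SJ.
have tJ := (supp_sub X SJ).1 sX.
have [j j0 Jj] := fractional_int FJ.
pose G := [set s : seq D | forall Q : Spec D, in_all s Q -> X Q].
pose J' := [set a : D | J (tofrac a)].
have J'I : ideal_or_unit J'.
  split=> [|a b Ja Jb|a b Jb]; rewrite /J' /=; first by rewrite tofrac0.
    by rewrite tofracD; apply: JD.
  by rewrite tofracM; apply: JM.
have [s Gs sJ] : exists2 s, G s & in_all s J'.
  apply: contrapT => noS.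
  have [| | |P J'P PG] := @prime_containing_no_list D G J' _ _ J'I.
  - by exists [:: 1] => Q /(_ 1 (mem_head _ _)) /Spec_proper.
  - move=> s t Gs Gt Q stQ.
    have [sQ|/existsNP[a /not_implyP[sa Qa]]] := pselect (in_all s Q).
      exact: Gs.
    apply: Gt => b tb.
    by have [] := @Spec_mul D Q a b (stQ _ (allpairs_f _ sa tb)).
  - by move=> s Gs sJ; apply: noS; exists s.
  have [XP|XP] := pselect (X P).
    by have [s sP Gs] := splitting_local hsplit XP; apply: PG sP.
  by have [[t Pt Jt] _] := tJ P XP; apply: Pt; apply: J'P.
(* The nonzero element [j] of [J] guards against [s] consisting of zeros; adding
   it keeps the list in [G]. *)
have [|A [IA sA Amin]] := @prufer_span D [seq tofrac a | a <- j :: s] hD.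
  by exists (tofrac j); rewrite ?mem_head // tofrac_eq0.
have [FA _] := IA; exists A; last first.
  apply: Amin => // _ /mapP[a + ->]; rewrite inE => /predU1P[->//|]; exact: sJ.
apply/Inv_onE; split=> // P XP; split; last first.
  apply: Amin; first exact: localization_submodule.
  by move=> _ /mapP[a _ ->]; apply: ring_localization; exists a.
apply: contrapT => noT; apply: XP; apply: Gs => a sa; apply: contrapT => Pa.
by apply: noT; exists a => //; apply: sA; rewrite /= inE map_f ?orbT.
Qed.

Lemma Div_on_bounds J : Div_on X J ->
  exists A B, [/\ Inv_on X A, Inv_on X B, A `<=` J & J `<=` B].
Proof.
move=> [[FJ dJ vJ] sJ sJ'].
have [A XA AJ] := Inv_on_below FJ sJ.
have [B XB BJ] := Inv_on_below (fractional_fcolon FJ) sJ'.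
exists A, (fcolon B); split=> //; first exact: Inv_on_fcolon.
by rewrite dJ; apply: fcolonS.
Qed.

(** For [P] outside [X], there are [t] in [A] and [u] in [(D : B)] outside [P], and
    [x ^+ n * t * u] is in [B (D : B)] for every [n].  So the primes containing
    all common denominators of the powers of [x] are in [X], hence maximal. *)
Lemma multiplier_sandwich A B J x : Inv_on X A -> Inv_on X B ->
  A `<=` J -> J `<=` B -> (forall y, J y -> J (x * y)) -> R x.
Proof.
move=> XA /Inv_on_fcolon XB AJ JB Jx.
have /Inv_onE[_ tA] := XA; have /Inv_onE[_ tB] := XB.
apply: almost_integral => // P CP; apply: hX; apply: contrapT => XP.
have [[t Pt At] _] := tA P XP; have [[u Pu Bu] _] := tB P XP.
apply: (Spec_mul_notin Pt Pu); apply: CP => n.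
rewrite tofracM mulrA mulrC; apply: Bu; apply: JB.
elim: n => [|n IH]; first by rewrite mul1r; apply: AJ.
by rewrite exprS -mulrA; apply: Jx.
Qed.

(** For the v-invertibility: [z J (D : J)] contained in [D] means that [z] maps
    [J] to the v-closure of [J], which is [J]; so [z] is in [D] by
    [multiplier_sandwich]. *)
Lemma Div_on_sandwich A B J : Inv_on X A -> Inv_on X B -> submodule J ->
  divisorial J -> A `<=` J -> J `<=` B -> Div_on X J.
Proof.
move=> XA XB SJ dJ AJ JB.
have [[[FA _] _] [[FB _] _]] := (XA, XB).
have FJ := fractional_sandwich FA FB SJ AJ JB.
have [/Inv_onE[_ tA] /Inv_onE[_ tB]] := (XA, XB).
have /Inv_onE[_ tA'] := Inv_on_fcolon XA; have /Inv_onE[_ tB'] := Inv_on_fcolon XB.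
split; last first.
- apply/(supp_sub X (fcolon_submodule J)).
  by apply: (trivial_off_sandwich tB' tA'); apply: fcolonS.
- by apply/(supp_sub X SJ); apply: (trivial_off_sandwich tA tB).
split=> //; exists (fcolon J); first exact: fractional_fcolon.
apply/seteqP; split.
  rewrite (Inv_divisorial (Inv_ring D)); exact/vclosureS/fmul_fcolon_le.
move=> r Rr z cz; apply: ring_in_fracM => //.
apply: (multiplier_sandwich XA XB AJ JB) => y Jy.
rewrite dJ => w cw; rewrite -mulrA; exact: (fcolon_fmulE _ _ _).1 cz _ _ Jy cw.
Qed.

Lemma Inv_on_Div_on : Inv_on X `<=` Div_on X.
Proof.
move=> I XI; have [II _] := XI; have [/fractional_submodule SI _] := II.
by apply: (Div_on_sandwich XI XI) => //; apply: Inv_divisorial.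
Qed.

Lemma Div_on_submodule J : Div_on X J -> submodule J.
Proof. by move=> [[/fractional_submodule]]. Qed.

Lemma Div_on_divisorial J : Div_on X J -> divisorial J.
Proof. by move=> [[]]. Qed.

Lemma Div_on_fcolon J : Div_on X J -> Div_on X (fcolon J).
Proof.
move=> [DJ sJ sJ']; split=> //; first exact: Div_fcolon.
by case: DJ => _ dJ _; rewrite -/(vclosure J) -dJ.
Qed.

Lemma Div_on_subgroup : subgroup (Div_group D) (Div_on X).
Proof.
split=> /=; [by move=> J []|exact/Inv_on_Div_on/Inv_on_ring| |].
  move=> I J XI XJ.
  have [A [B [XA XB AI IB]]] := Div_on_bounds XI.
  have [A' [B' [XA' XB' AJ JB]]] := Div_on_bounds XJ.
  apply: (Div_on_sandwich (Inv_on_fmul XA XA') (Inv_on_fmul XB XB')).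
  - exact: fcolon_submodule.
  - exact: divisorial_fcolon.
  - apply: subset_trans (@vclosure_ge _ _); exact: fmulS.
  - have [[IB' _] [IB'' _]] := (XB, XB').
    by rewrite -(Inv_vmul IB' IB''); apply: vmulS.
move=> J XJ; exists (fcolon J); first exact: Div_on_fcolon.
by case: XJ => -[_ _ vJ] _ _; apply: vmul_fcolon.
Qed.

Lemma Div_on_convex : convex_subgroup (Div_group D) (Div_on X).
Proof.
split; [exact: Div_ordered_group|exact: Div_on_subgroup|].
move=> I J N XI [FJ dJ vJ] XN [/= JI _] [NJ _].
have [_ [B [_ XB _ IB]]] := Div_on_bounds XI.
have [A [_ [XA _ AN _]]] := Div_on_bounds XN.
apply: (Div_on_sandwich XA XB) => //; first exact: fractional_submodule.
  exact: subset_trans NJ.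
exact: subset_trans IB.
Qed.

(** * Suprema, infima and density *)

Local Notation InvX := (pog_restrict (Inv_group D) (Inv_on X)).
Local Notation DivX := (pog_restrict (Div_group D) (Div_on X)).

Lemma Div_on_bigcap (S : set (set K)) U : S `<=` Div_on X -> S !=set0 ->
  Div_on X U -> (forall J, S J -> U `<=` J) -> Div_on X (\bigcap_(J in S) J).
Proof.
move=> SX [J0 SJ0] XU US.
have [A [_ [XA _ AU _]]] := Div_on_bounds XU.
have [_ [B [_ XB _ JB]]] := Div_on_bounds (SX _ SJ0).
apply: (Div_on_sandwich XA XB).
- split=> [J /SX/Div_on_submodule[]//|x y Sx Sy J SJ|a x Sx J SJ].
    have [_ JD _] := Div_on_submodule (SX _ SJ).
    by apply: JD; [apply: Sx|apply: Sy].
  by have [_ _ JM] := Div_on_submodule (SX _ SJ); apply: JM; exact: Sx.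
- apply/seteqP; split; first exact: vclosure_ge.
  move=> x vx J SJ; rewrite (Div_on_divisorial (SX _ SJ)).
  by apply: vclosureS vx => y Sy; exact: Sy.
- by move=> x /AU Ux J SJ; apply: US.
- by move=> x Sx; apply: JB; exact: Sx.
Qed.

Lemma DivX_ordered_group : ordered_group DivX.
Proof. exact: ordered_group_restrict (Div_ordered_group D) Div_on_subgroup. Qed.

Lemma DivX_sup (S : set (set K)) U : S `<=` Div_on X -> S !=set0 ->
  Div_on X U -> (forall J, S J -> U `<=` J) ->
  pog_is_sup DivX S (\bigcap_(J in S) J).
Proof.
move=> SX S0 XU US; split; first split=> /=.
- exact: Div_on_bigcap US.
- by move=> J SJ x; apply.
- by move=> V [XV VS] x Vx J SJ; apply: VS.
Qed.

Lemma DivX_sup2 A B : Div_on X A -> Div_on X B ->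
  exists m, pog_is_sup DivX [set A; B] m.
Proof.
move=> XA XB.
have [A' [_ [XA' _ AA' _]]] := Div_on_bounds XA.
have [B' [_ [XB' _ BB' _]]] := Div_on_bounds XB.
exists (\bigcap_(J in [set A; B]) J).
apply: (DivX_sup (U := A' `&` B')).
- by move=> _ [->|->].
- by exists A; left.
- exact/Inv_on_Div_on/Inv_on_meet.
- by move=> _ [->|->] x [A'x B'x]; [apply: AA'|apply: BB'].
Qed.

(** [J |-> (D : J)] is an order-reversing involution of the divisorial ideals, so
    it turns suprema into infima. *)
Lemma DivX_inf2 A B : Div_on X A -> Div_on X B ->
  exists m, pog_is_inf DivX [set A; B] m.
Proof.
move=> XA XB.
have [m [[/= Xm ubm] leastm]] := DivX_sup2 (Div_on_fcolon XA) (Div_on_fcolon XB).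
exists (fcolon m); split; first split=> /=; first exact: Div_on_fcolon.
  move=> J JAB; rewrite /rev_incl.
  have -> : J = vclosure J by case: JAB => ->; apply: Div_on_divisorial.
  by apply: fcolonS; apply: (ubm (fcolon J)); case: JAB => ->; [left|right].
move=> l [/= Xl lbl]; rewrite /= /rev_incl (Div_on_divisorial Xl).
apply/fcolonS/leastm; split; first exact: Div_on_fcolon.
by move=> _ [->|->]; apply: fcolonS; apply: lbl; [left|right].
Qed.

Lemma DivX_complete : complete_lgroup DivX.
Proof.
split; last first.
  by move=> S SX S0 [U [XU US]]; exists (\bigcap_(J in S) J); apply: DivX_sup US.
split; first exact: DivX_ordered_group.
by move=> A B XA XB; split; [apply: DivX_sup2|apply: DivX_inf2].
Qed.

Lemma InvX_sup2 A B : Inv_on X A -> Inv_on X B ->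
  pog_is_sup InvX [set A; B] (A `&` B).
Proof.
move=> XA XB; split; first split=> /=; first exact: Inv_on_meet.
  by move=> _ [->|->] x [].
move=> u [Xu ubu] x ux.
by split; [apply: (ubu A)|apply: (ubu B)]; rewrite //=; [left|right].
Qed.

Lemma InvX_lgroup : lgroup InvX.
Proof.
split.
  exact: ordered_group_restrict (Inv_ordered_group D) (Inv_on_subgroup X).
move=> A B XA XB; split; first by exists (A `&` B); apply: InvX_sup2.
have [N [XN AN BN Nmin]] := Inv_on_join hD XA XB; exists N.
split; first by split=> //= _ [->|->].
move=> l [/= Xl lbl]; apply: Nmin; [exact/Div_on_submodule/Inv_on_Div_on| |].
  by apply: lbl; left.
by apply: lbl; right.
Qed.

Lemma InvX_lsubgroup : lsubgroup InvX DivX.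
Proof.
split=> /=.
- exact: InvX_lgroup.
- by case: DivX_complete.
- exact: Inv_on_Div_on.
- by move=> A B [IA _] [IB _]; rewrite Inv_vmul.
- by [].
- move=> A B m XA XB [[/= Xm ubm] leastm].
  have [ubAB _] := InvX_sup2 XA XB.
  split; first by split=> //=; apply: Inv_on_Div_on.
  move=> u [/= Xu ubu] x ux; apply: (leastm _ ubAB).
  by split; [apply: (ubu A)|apply: (ubu B)]; rewrite //=; [left|right].
- move=> A B m XA XB [[/= Xm lbm] greatm].
  split; first by split=> //=; apply: Inv_on_Div_on.
  move=> l [/= Xl lbl].
  have [N [XN AN BN Nmin]] := Inv_on_join hD XA XB.
  apply: subset_trans (Nmin _ (Div_on_submodule Xl) _ _).
  + by apply: greatm; split=> //= _ [->|->].
  + by apply: lbl; left.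
  + by apply: lbl; right.
Qed.

(** The span of [x] and a lower bound [A] of [J] is invertible, and it lies between
    [A] and [J]. *)
Lemma Inv_on_cover J x : Div_on X J -> J x ->
  exists A, [/\ Inv_on X A, A `<=` J & A x].
Proof.
move=> XJ Jx; have [A [B [XA XB AJ JB]]] := Div_on_bounds XJ.
have [[IA _] SJ] := (XA, Div_on_submodule XJ).
have [N [IN AN sN Nmin]] := Inv_adjoin [:: x] hD IA.
have NJ : N `<=` J by apply: Nmin => // y; rewrite inE => /eqP->.
exists N; split=> //; last by apply: sN; rewrite mem_head.
by apply: (Inv_on_sandwich XA XB) => //; apply: subset_trans JB.
Qed.

(** [J] is the union of the invertible ideals it contains.  For the supremum, the
    same for [(D : J)]: an element [x] lying in [(D : A)] for every [A] of
    Inv_X contained in [(D : J)] multiplies [(D : J)] into [D]. *)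
Lemma InvX_dense J : Div_on X J ->
  pog_is_sup DivX [set A | Inv_on X A /\ rev_incl A J] J /\
  pog_is_inf DivX [set A | Inv_on X A /\ rev_incl J A] J.
Proof.
move=> XJ; split; split; try by split=> // A [].
  move=> u [/= Xu ubu] x ux; rewrite (Div_on_divisorial XJ) => y cy.
  have [A [XA AJ Ay]] := Inv_on_cover (Div_on_fcolon XJ) cy.
  suff cAx : fcolon A x by apply: cAx.
  apply: (ubu (fcolon A)) => //; split; first exact: Inv_on_fcolon.
  by rewrite /rev_incl (Div_on_divisorial XJ); apply: fcolonS.
move=> l [/= Xl lbl] x Jx; have [A [XA AJ Ax]] := Inv_on_cover XJ Jx.
by apply: (lbl A).
Qed.

End Splitting.

Theorem theorem4p5 (D : idomainType) (hD : prufer D)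
    (X : set (Spec D)) (hX : X `<=` @Max D) (hsplit : splitting_set X) :
  [/\ convex_subgroup (Div_group D) (Div_on X),
      complete_lgroup (pog_restrict (Div_group D) (Div_on X)) &
      is_completion (pog_restrict (Inv_group D) (Inv_on X))
                    (pog_restrict (Div_group D) (Div_on X))].
Proof.
have complete := DivX_complete hD hX hsplit.
split=> //; first exact: Div_on_convex.
by split=> //; [exact: InvX_lsubgroup|exact: InvX_dense].
Qed.
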